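(* Let $f,g_1,\dots,g_m,h_1,\dots,h_l\in\mathbb{R}[\mathbf{x}]$ with correlative sparsity data $(I_j,J_j,W_j)_{j\in[p]}$ as in the context. Assume that for every $j\in[p]$ there is $R_j>0$ such that $R_j-\|\mathbf{x}(I_j)\|_2^2\in\{g_1,\dots,g_m\}$. Then $(0,\infty)\subseteq Q_k^\circ(g_{J_j})$ for all integers $k\ge k_{\min}$ and all $j\in[p]$. As a consequence, the POP of minimizing $f$ over $S(g)\cap V(h)$ has the constant trace property with correlative sparsity.
   Context: $\mathbf{x}=(x_1,\dots,x_n)$; for $I\subseteq[n]$, $\mathbf{x}(I)=(x_i)_{i\in I}$. $\lceil p\rceil:=\lceil\deg(p)/2\rceil$; $k_{\min}:=\max\{\lceil f\rceil,\lceil g_i\rceil,\lceil h_j\rceil\}$; $S(g)=\{\mathbf{x}:g_i(\mathbf{x})\ge0\}$, $V(h)=\{\mathbf{x}:h_j(\mathbf{x})=0\}$. Sparsity data: $I_1,\dots,I_p\subseteq[n]$ (in the paper, the maximal cliques of a chordal extension of the correlative sparsity pattern graph), $n_j:=|I_j|$; $\{J_j\}_{j\in[p]}$ a partition of $[m]$ and $\{W_j\}_{j\in[p]}$ a partition of $[l]$ such that $g_i\in\mathbb{R}[\mathbf{x}(I_j)]$ for $i\in J_j$ and $h_i\in\mathbb{R}[\mathbf{x}(I_j)]$ for $i\in W_j$; $g_{J_j}:=\{g_i:i\in J_j\}$. $\mathbb{N}^I_d:=\{\alpha\in\mathbb{N}^n:|\alpha|\le d,\ \mathrm{supp}(\alpha)\subseteq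 I\}$, $\mathbf{v}^I_d:=(\mathbf{x}^\alpha)_{\alpha\in\mathbb{N}^I_d}$, of length $s(d,|I|)=\binom{|I|+d}{d}$. $Q_k^\circ(g_{J_j}):=\{(\mathbf{v}^{I_j}_k)^\top\mathbf{G}_0\mathbf{v}^{I_j}_k+\sum_{i\in J_j}g_i(\mathbf{v}^{I_j}_{k-\lceil g_i\rceil})^\top\mathbf{G}_i\mathbf{v}^{I_j}_{k-\lceil g_i\rceil}:\ \mathbf{G}_0,\mathbf{G}_i \text{ real symmetric positive definite}\}$. For $\mathbf{y}=(y_\alpha)_{\alpha\in\mathbb{N}^n_{2k}}$: $\mathbf{M}_d(\mathbf{y},I)=(y_{\alpha+\beta})_{\alpha,\beta\in\mathbb{N}^I_d}$, $\mathbf{M}_d(q\mathbf{y},I)=(\sum_\gamma q_\gamma y_{\alpha+\beta+\gamma})_{\alpha,\beta\in\mathbb{N}^I_d}$ for $q\in\mathbb{R}[\mathbf{x}(I)]$; $\mathbf{D}_k(\mathbf{y},I_j):=\mathrm{diag}(\mathbf{M}_k(\mathbf{y},I_j),(\mathbf{M}_{k-\lceil g_i\rceil}(g_i\mathbf{y},I_j))_{i\in J_j})$. CTP with correlative sparsity: for every integer $k\ge k_{\min}$ and every $j\in[p]$ there exist $a^{(j)}_k>0$ and a positive definite matrix $\mathbf{P}^{(j)}_k$ with the same block-diagonal structure as $\mathbf{D}_k(\mathbf{y},I_j)$ such that every $\mathbf{y}\in\mathbb{R}^{s(2k)}$ with $\mathbf{M}_{k-\lceil h_i\rceil}(h_i\mathbf{y},I_j)=0$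 ($i\in W_j$) and $y_{\mathbf{0}}=1$ satisfies $\mathrm{trace}(\mathbf{P}^{(j)}_k\mathbf{D}_k(\mathbf{y},I_j)\mathbf{P}^{(j)}_k)=a^{(j)}_k$. *)

(* Defs.v *)
From HB Require Import structures.
From mathcomp Require Import all_boot all_order all_algebra.
From mathcomp Require Import reals.
From mathcomp Require Import mpoly.

Set Implicit Arguments.
Unset Strict Implicit.
Unset Printing Implicit Defensive.

Import Order.TTheory GRing.Theory Num.Theory.
Local Open Scope ring_scope.

Section Defs.
Variable R : realType.
Variable n : nat.

(* ceil(deg p / 2); deg 0 is taken to be 0 *)
Definition cdeg (p : {mpoly R[n]}) : nat := uphalf (msize p).-1.

Definition poly_in (I : {set 'I_n}) (q : {mpoly R[n]}) : Prop :=
  forall m, m \in msupp q -> forall i : 'I_n, i \notin I -> m i = 0%N.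

Definition mset (I : {set 'I_n}) (d : nat) : {set 'X_{1..n < d.+1}} :=
  [set m : 'X_{1..n < d.+1} | [forall i : 'I_n, (i \notin I) ==> (m i == 0%N)]].

Definition msz (I : {set 'I_n}) (d : nat) : nat := #|mset I d|.

Definition mon (I : {set 'I_n}) (d : nat) (t : 'I_(msz I d)) : 'X_{1..n} :=
  bmnm (enum_val t).

Definition quadform (I : {set 'I_n}) (d : nat) (G : 'M[R]_(msz I d))
  : {mpoly R[n]} :=
  \sum_(s < msz I d) \sum_(t < msz I d) G s t *: 'X_[(mon s + mon t)%MM].

Definition posdef (N : nat) (A : 'M[R]_N) : Prop :=
  A^T = A /\ forall v : 'cV[R]_N, v != 0 -> 0 < (v^T *m A *m v) 0 0.

(* membership in Q_k^circ(g_{J_j}); J : 'I_m -> 'I_p encodes the partition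
   {J_j}: J_j = [set i | J i == j] *)
Definition Qcirc (m p : nat) (k : nat) (Ij : {set 'I_n})
  (g : 'I_m -> {mpoly R[n]}) (J : 'I_m -> 'I_p) (j : 'I_p)
  (q : {mpoly R[n]}) : Prop :=
  exists G0 : 'M[R]_(msz Ij k), posdef G0 /\
  exists G : forall i : 'I_m, 'M[R]_(msz Ij (k - cdeg (g i))),
    (forall i, J i = j -> posdef (G i)) /\
    q = quadform G0 + \sum_(i < m | J i == j) g i * quadform (G i).

Definition ymom (k : nat) (y : {ffun 'X_{1..n < (2 * k).+1} -> R})
  (a : 'X_{1..n}) : R :=
  if insub a is Some b then y b else 0.

Definition momat (k : nat) (y : {ffun 'X_{1..n < (2 * k).+1} -> R})
  (I : {set 'I_n}) (d : nat) : 'M[R]_(msz I d) :=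
  \matrix_(s, t) ymom y (mon s + mon t)%MM.

Definition locmat (k : nat) (y : {ffun 'X_{1..n < (2 * k).+1} -> R})
  (q : {mpoly R[n]}) (I : {set 'I_n}) (d : nat) : 'M[R]_(msz I d) :=
  \matrix_(s, t) \sum_(c <- msupp q) q@_c * ymom y (mon s + mon t + c)%MM.

Definition kmin (m l : nat) (f : {mpoly R[n]}) (g : 'I_m -> {mpoly R[n]})
  (h : 'I_l -> {mpoly R[n]}) : nat :=
  maxn (cdeg f) (maxn (\max_(i < m) cdeg (g i)) (\max_(i < l) cdeg (h i))).

(* Constant trace property with correlative sparsity.  The block-diagonal
   matrix P^(j)_k = diag(P0, (P i)_{i in J_j}) is given by its blocks, and
   trace(P D_k(y,I_j) P) is the sum of the blockwise traces. *)
Definition CTP_cs (m l p : nat) (f : {mpoly R[n]})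
  (g : 'I_m -> {mpoly R[n]}) (h : 'I_l -> {mpoly R[n]})
  (I : 'I_p -> {set 'I_n}) (J : 'I_m -> 'I_p) (W : 'I_l -> 'I_p) : Prop :=
  forall k : nat, (kmin f g h <= k)%N -> forall j : 'I_p,
  exists a : R, 0 < a /\
  exists P0 : 'M[R]_(msz (I j) k), posdef P0 /\
  exists P : forall i : 'I_m, 'M[R]_(msz (I j) (k - cdeg (g i))),
    (forall i, J i = j -> posdef (P i)) /\
    forall y : {ffun 'X_{1..n < (2 * k).+1} -> R},
      (forall i : 'I_l, W i = j -> locmat y (h i) (I j) (k - cdeg (h i)) = 0) ->
      ymom y 0%MM = 1 ->
      \tr (P0 *m momat y (I j) k *m P0)
      + \sum_(i < m | J i == j) \tr (P i *m locmat y (g i) (I j) (k - cdeg (g i)) *m P i)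
      = a.

End Defs.

(* Main.v *)
(* With w_a = c / (2 r)^(|a| + 1), the polynomial
   c - (r - |x|^2) * \sum_a w_a x^(2a) is a combination of squared monomials with
   positive coefficients, since w_a = 2 r w_(a + e_v).  This writes c with diagonal
   positive definite Gram matrices for the ball constraint and the constant weight.
   A multiple of the identity is then inserted at every other constraint: its
   contribution has some symmetric Gram matrix, and subtracting a small multiple
   of that matrix keeps the first block positive definite.
   For the trace property, take positive definite square roots of the Gram
   matrices representing 1 and apply the Riesz functional of y. *)
Require Import Defs.
From HB Require Import structures.
From mathcomp Require Import all_boot all_order all_algebra.
From mathcomp Require Import reals.
From mathcomp Require Import mpoly.
From mathcomp Require Import complex.
From mathcomp Require Import zify ring lra.

Set Implicit Arguments.
Unset Strict Implicit.
Unset Printing Implicit Defensive.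

Import Order.TTheory GRing.Theory Num.Theory.
Local Open Scope ring_scope.

(** * Gram forms and symmetric Gram matrices of sparse polynomials *)

Lemma quadform_is_linear (R : realType) n (I : {set 'I_n}) d :
  linear (@quadform R n I d).
Proof.
move=> a A B; rewrite /quadform scaler_sumr -big_split; apply: eq_bigr => s _.
rewrite scaler_sumr -big_split; apply: eq_bigr => t _ /=.
by rewrite !mxE scalerDl scalerA.
Qed.
HB.instance Definition _ (R : realType) n (I : {set 'I_n}) d :=
  GRing.isLinear.Build R 'M[R]_(msz I d) {mpoly R[n]} _ (@quadform R n I d)
    (@quadform_is_linear R n I d).

Lemma quadform_delta (R : realType) n (I : {set 'I_n}) d (s t : 'I_(msz I d)) :
  quadform (delta_mx s t) = 'X_[R, (mon s + mon t)%MM].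
Proof.
rewrite /quadform (bigD1 s) //= (bigD1 t) //= mxE !eqxx scale1r.
rewrite [X in _ + X + _]big1 => [|t' /negPf tt']; last first.
  by rewrite mxE eqxx tt' scale0r.
rewrite [X in _ + X]big1 ?addr0 // => s' /negPf ss'.
by rewrite big1 // => t' _; rewrite mxE ss' scale0r.
Qed.

Lemma quadform_diag (R : realType) n (I : {set 'I_n}) d (u : 'rV[R]_(msz I d)) :
  quadform (diag_mx u) = \sum_s u 0 s *: 'X_[(mon s + mon s)%MM].
Proof.
rewrite diag_mx_sum_delta linear_sum; apply: eq_bigr => s _.
by rewrite linearZ /= quadform_delta.
Qed.

Lemma quadform_tr (R : realType) n (I : {set 'I_n}) d (A : 'M[R]_(msz I d)) :
  quadform A^T = quadform A.
Proof.
rewrite /quadform exchange_big; apply: eq_bigr => s _.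
by apply: eq_bigr => t _; rewrite mxE addmC.
Qed.

Lemma mdeg_mon n (I : {set 'I_n}) d (s : 'I_(msz I d)) : (mdeg (mon s) <= d)%N.
Proof. by rewrite -ltnS /mon bmdeg. Qed.

Lemma mon_notin n (I : {set 'I_n}) d (s : 'I_(msz I d)) i :
  i \notin I -> mon s i = 0%N.
Proof.
by move=> iI; have := enum_valP s; rewrite inE => /forallP/(_ i); rewrite iI => /eqP.
Qed.

Lemma mon_inj n (I : {set 'I_n}) d : injective (@mon n I d).
Proof. by move=> s t /val_inj/enum_val_inj. Qed.

Lemma mon_surj n (I : {set 'I_n}) d (a : 'X_{1..n}) :
  (mdeg a <= d)%N -> (forall i, i \notin I -> a i = 0%N) ->
  exists s : 'I_(msz I d), mon s = a.
Proof.
rewrite -ltnS => ad aI; pose b := BMultinom ad.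
have bI : b \in mset I d.
  by rewrite inE; apply/forallP => i; apply/implyP => /aI /eqP.
by exists (enum_rank_in bI b); rewrite /mon enum_rankK_in.
Qed.

(** Induction on [d]: while the degree of [a] is below that of [c], some exponent can still be
    raised. This serves to split a monomial of degree at most 2k into two factors of degree at most
    k. *)
Lemma mnm_subdeg n (c : 'X_{1..n}) d : (d <= mdeg c)%N ->
  exists2 a, (a <= c)%MM & mdeg a = d.
Proof.
elim: d => [|d IH] dc.
  by exists 0%MM; [apply/mnm_lepP => i; rewrite mnm0E | rewrite mdeg0].
have [a ac ad] := IH (ltnW dc).
have [i ai] : exists i, (a i < c i)%N.
  apply/existsP; apply: contraTT dc; rewrite negb_exists => /forallP ca.
  rewrite -leqNgt -ad !mdegE leq_sum // => i _.
  by rewrite leqNgt ca.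
exists (a + U_(i))%MM; last by rewrite mdegD mdeg1 ad addn1.
apply/mnm_lepP => j; rewrite mnmDE mnm1E.
by have [<-|_] := eqVneq i j; rewrite ?addn1 ?addn0 //; apply/mnm_lepP.
Qed.

(** Symmetry is demanded because these matrices get subtracted from a positive definite one, which
    [posdef] requires to be symmetric. *)
Definition sym_gram (R : realType) n (I : {set 'I_n}) k (q : {mpoly R[n]}) : Prop :=
  exists2 H : 'M[R]_(msz I k), H^T = H & q = quadform H.

Lemma sym_gram_sum (R : realType) n (I : {set 'I_n}) k (T : Type) (s : seq T)
    (P : pred T) (F : T -> {mpoly R[n]}) :
  (forall i, P i -> sym_gram I k (F i)) -> sym_gram I k (\sum_(i <- s | P i) F i).
Proof.
apply: big_ind => [|_ _ [H1 h1 ->] [H2 h2 ->]].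
  by exists 0; rewrite ?trmx0 ?linear0.
by exists (H1 + H2); rewrite linearD //= h1 h2.
Qed.

Lemma sym_gramZ (R : realType) n (I : {set 'I_n}) k (a : R) (q : {mpoly R[n]}) :
  sym_gram I k q -> sym_gram I k (a *: q).
Proof. by move=> [H h ->]; exists (a *: H); rewrite linearZ //= h. Qed.

(** Take [a] below [c] of degree min(k, |c|); then [a] and [c - a] both index rows, and the matrix
    unit at their crossing is symmetrized. *)
Lemma sym_gram_monomial (R : realType) n (I : {set 'I_n}) k (c : 'X_{1..n}) :
  (mdeg c <= 2 * k)%N -> (forall i, i \notin I -> c i = 0%N) ->
  sym_gram I k 'X_[R, c].
Proof.
move=> ck cI; have [a ac ad] := mnm_subdeg (geq_minr k (mdeg c)).
have caE := submK ac.
have [s sa] : exists s : 'I_(msz I k), mon s = a.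
  apply: mon_surj => [|i iI]; first by rewrite ad geq_minl.
  by apply/eqP; rewrite -leqn0 -(cI i iI); apply/mnm_lepP.
have [t tb] : exists t : 'I_(msz I k), mon t = (c - a)%MM.
  apply: mon_surj => [|i iI]; last by rewrite mnmBE cI.
  move: ck; rewrite -{1}caE mdegD ad; have := mdegB c a.
  by rewrite /minn; case: ifP => _; lia.
exists (2^-1 *: (delta_mx s t + (delta_mx s t)^T)).
  by rewrite linearZ /= linearD /= trmxK addrC.
rewrite linearZ linearD /= quadform_tr quadform_delta sa tb addmC caE.
by rewrite -mulr2n -scaler_nat scalerA mulVf ?scale1r // pnatr_eq0.
Qed.

(** Every monomial of the product is supported in [I] and has degree at most 2 [cdeg g] + 2 (k -
    [cdeg g]) = 2k. *)
Lemma sym_gram_mul (R : realType) n (I : {set 'I_n}) k (g : {mpoly R[n]})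
    (G : 'M[R]_(msz I (k - cdeg g))) :
  poly_in I g -> (cdeg g <= k)%N ->
  sym_gram I k (g * quadform G).
Proof.
move=> gI gk.
rewrite [X in X * _]mpolyE mulr_suml big_seq; apply: sym_gram_sum => c cg.
rewrite -scalerAl mulr_sumr; apply/sym_gramZ/sym_gram_sum => s _.
rewrite mulr_sumr; apply: sym_gram_sum => t _.
rewrite -scalerAr -mpolyXD; apply/sym_gramZ/sym_gram_monomial => [|i iI].
  have := msize_mdeg_lt cg.
  rewrite !mdegD; move: gk (mdeg_mon s) (mdeg_mon t); rewrite /cdeg.
  by lia.
by rewrite !mnmDE !mon_notin // (gI c cg i iI).
Qed.

(** * Square roots of positive definite matrices *)

(** Newton interpolation: a multiple of the product vanishing on the old nodes corrects the value at
    the new one. *)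
Lemma exists_interpolation (F : fieldType) (u : F -> F) (s : seq F) :
  exists q : {poly F}, forall x, x \in s -> q.[x] = u x.
Proof.
elim: s => [|y s [q hq]]; first by exists 0.
have [ys|ys] := boolP (y \in s).
  by exists q => x; rewrite inE => /predU1P[->|]; exact: hq.
pose w := \prod_(z <- s) ('X - z%:P).
have wy : w.[y] != 0 by rewrite -[_ == 0]/(root w y) root_prod_XsubC.
exists (q + ((u y - q.[y]) / w.[y])%:P * w) => x.
rewrite inE !hornerE => /predU1P[->|xs]; first by rewrite divfK // addrC subrK.
have /eqP -> : root w x by rewrite root_prod_XsubC.
by rewrite mulr0 addr0 hq.
Qed.

Lemma trmx_horner_mx (F : fieldType) (N : nat) (A : 'M[F]_N.+1) (q : {poly F}) :
  A^T = A -> (horner_mx A q)^T = horner_mx A q.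
Proof.
move=> symA; elim/poly_ind: q => [|q c IH]; first by rewrite !rmorph0 trmx0.
rewrite rmorphD rmorphM /= horner_mx_X horner_mx_C linearD /= tr_scalar_mx.
rewrite trmx_mul symA IH; congr (_ + _); exact: comm_mx_horner.
Qed.

Lemma mulmx_tr_ge0 (R : realDomainType) N (v : 'cV[R]_N) : 0 <= (v^T *m v) 0 0.
Proof. by rewrite mxE sumr_ge0 // => i _; rewrite mxE -expr2 sqr_ge0. Qed.

Lemma mulmx_tr_gt0 (R : realDomainType) N (v : 'cV[R]_N) :
  v != 0 -> 0 < (v^T *m v) 0 0.
Proof.
move=> v0; rewrite lt_neqAle mulmx_tr_ge0 andbT eq_sym; apply: contraNneq v0.
rewrite mxE => /eqP; rewrite psumr_eq0 => [/allP h|i _]; last first.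
  by rewrite mxE -expr2 sqr_ge0.
apply/eqP/matrixP => i j; rewrite ord1 mxE; apply/eqP.
by have := h i (mem_index_enum i); rewrite mxE -expr2 sqrf_eq0.
Qed.

Lemma posdef_eigenvalue_gt0 (R : realType) N (A : 'M[R]_N) (a : R) :
  posdef A -> eigenvalue A a -> 0 < a.
Proof.
move=> [_ pA] /eigenvalueP[v vA v0].
have v0' : v^T != 0.
  by apply: contraNneq v0 => /(congr1 trmx); rewrite trmxK trmx0 => ->.
have := pA _ v0'; rewrite trmxK vA -scalemxAl mxE -{1}(trmxK v).
by rewrite pmulr_lgt0 // mulmx_tr_gt0.
Qed.

(** The spectral theorem is applied to the complexification [B] of [A]. The root is nevertheless
    real and symmetric, being built from a real polynomial in [A] that interpolates fourth roots at
    the eigenvalues. *)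
Lemma posdef_sqrt (R : realType) (N : nat) (A : 'M[R]_N) :
  posdef A -> exists P : 'M[R]_N, posdef P /\ P *m P = A.
Proof.
case: N A => [|N] A pA.
  by exists A; split=> //; apply/matrixP => -[].
have [symA Apos] := pA.
pose C : numClosedFieldType := R[i]%C.
pose phi : {rmorphism R -> C} := real_complex R.
pose B : 'M[C]_N.+1 := map_mx phi A.
have Bherm : B \is hermitianmx _ false Num.conj.
  apply: realsym_hermsym.
    apply/is_hermitianmxP; rewrite expr0 scale1r map_mx_id //.
    by rewrite /B map_trmx symA.
  apply/mxOverP => i j; rewrite mxE.
  by apply/complex_realP; exists (A i j).
have Bspec := orthomx_spectralP (hermitian_normalmx Bherm).
set U := spectralmx B in Bspec; set d := spectral_diag B in Bspec.
have Uu : U \in unitmx by exact: spectral_unit.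
have dreal j : exists e, d 0 j = phi e.
  have /mxOverP/(_ 0 j) := hermitian_spectral_diag_real Bherm.
  by move=> /complex_realP.
(* Row [j] of [U] is a left eigenvector of [B]; the eigenvalue descends to [A] as a root of the
   characteristic polynomial. *)
have dpos e j : d 0 j = phi e -> 0 < e.
  move=> de; apply: (posdef_eigenvalue_gt0 pA).
  rewrite eigenvalue_root_char -(fmorph_root phi) map_char_poly.
  rewrite -eigenvalue_root_char -de; apply/eigenvalueP; exists (row j U).
    rewrite -row_mul -[map_mx _ _]/B {1}Bspec !mulmxA mulmxV // mul1mx.
    by apply/rowP => k; rewrite row_mul row_diag_mx -scalemxAl -rowE !mxE.
  apply/eqP => r0; have := mulmxK Uu (delta_mx 0 j : 'rV[C]_N.+1).
  rewrite -rowE r0 mul0mx => /matrixP/(_ 0 j)/eqP.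
  by rewrite !mxE !eqxx eq_sym oner_eq0.
have [q hq] := exists_interpolation (fun e => Num.sqrt (Num.sqrt e))
                 [seq complex.Re (d 0 j) | j : 'I_N.+1].
(* Fourth roots: as A = T ^ 4 with T symmetric, T ^ 2 is positive definite because
   v^T T^2 v = |T v|^2 and T v = 0 forces A v = 0. *)
pose T := horner_mx A q.
have symT : T^T = T by exact: trmx_horner_mx.
have T4 : (T *m T) *m (T *m T) = A.
  (* Over the complex numbers [B] is U^-1 diag(d) U, so [T] becomes U^-1 diag(q(d)) U and only
     q(d_j)^4 = d_j remains to be checked. *)
  apply: (map_mx_inj (f := phi)); rewrite !map_mxM map_horner_mx -/B.
  rewrite {1 2 3 4}Bspec horner_mx_uconjC // horner_mx_diag.
  rewrite !mulmxA !mulmxK // [RHS]Bspec.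
  rewrite -!(mulmxA (invmx U)) !mulmx_diag.
  congr (_ *m (diag_mx _ *m _)); apply/rowP => j; rewrite !mxE.
  have [e de] := dreal j; rewrite de horner_map hq; last first.
    by apply/imageP; exists j; rewrite // de.
  rewrite -!rmorphM; congr (phi _).
  by rewrite -mulrA -!expr2 sqr_sqrtr ?sqrtr_ge0 // sqr_sqrtr // ltW // (dpos _ _ de).
exists (T *m T); split=> //; split; first by rewrite trmx_mul symT.
move=> v v0.
have Tv : T *m v != 0.
  apply: contraTneq (Apos v v0) => Tv0.
  by rewrite -T4 -!mulmxA Tv0 !mulmx0 mxE ltxx.
by have := mulmx_tr_gt0 Tv; rewrite trmx_mul symT !mulmxA.
Qed.

(** * Positive diagonal matrices and their small perturbations *)

Lemma posdef_diag (R : realType) N (u : 'rV[R]_N) :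
  (forall s, 0 < u 0 s) -> posdef (diag_mx u).
Proof.
move=> u0; split; first exact: tr_diag_mx.
move=> v v0; rewrite mul_mx_diag mxE.
have [s vs] : exists s, v s 0 != 0.
  by apply/existsP; apply: contraR v0; rewrite negb_exists => /forallP h;
     apply/eqP/matrixP => i j; rewrite ord1 mxE; apply/eqP; rewrite -[_ == _]negbK.
rewrite (bigD1 s) //= ltr_wpDr ?sumr_ge0 // => [t _|].
  by rewrite !mxE mulrAC -expr2 mulr_ge0 ?sqr_ge0 // ltW.
by rewrite !mxE mulrAC -expr2 mulr_gt0 // lt_neqAle sqr_ge0 eq_sym sqrf_eq0 vs.
Qed.

(** Let Q = v^T diag(u) v. Each v_s^2 is at most K Q, hence v^T H v is at most B K Q, and e = 1 / (1
    + B K) makes e B K less than 1. *)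
Lemma posdef_diag_perturb (R : realType) N (u : 'rV[R]_N) (H : 'M[R]_N) :
  (forall s, 0 < u 0 s) -> H^T = H ->
  exists2 e, 0 < e & posdef (diag_mx u - e *: H).
Proof.
move=> u0 symH; pose B := \sum_t \sum_s `|H s t|.
have [K K0 uK] : exists2 K, 0 <= K & forall s, (u 0 s)^-1 <= K.
  exists (\sum_s (u 0 s)^-1) => [|s].
    by rewrite sumr_ge0 // => s _; rewrite invr_ge0 ltW.
  by rewrite (bigD1 s) //= lerDl sumr_ge0 // => t _; rewrite invr_ge0 ltW.
have B0 : 0 <= B by apply: sumr_ge0 => s _; apply: sumr_ge0.
have BK : 0 < 1 + B * K by rewrite ltr_wpDr ?mulr_ge0.
exists (1 + B * K)^-1; rewrite ?invr_gt0 //; split.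
  by rewrite linearB linearZ /= tr_diag_mx symH.
move=> v v0; have [_ /(_ v v0)] := posdef_diag u0.
rewrite mulmxBr mulmxBl -scalemxAr -scalemxAl.
set X := v^T *m diag_mx u *m v; set Y := v^T *m H *m v.
have -> e : (X - e *: Y) 0 0 = X 0 0 - e * Y 0 0 by rewrite !mxE.
pose Q : R := X 0 0; rewrite -/Q => Q0.
have QE : Q = \sum_s u 0 s * v s 0 ^+ 2.
  rewrite /Q /X mul_mx_diag mxE; apply: eq_bigr => s _.
  by rewrite !mxE mulrAC -expr2 mulrC.
have vK s : v s 0 ^+ 2 <= K * Q.
  have h : u 0 s * v s 0 ^+ 2 <= Q.
    rewrite QE (bigD1 s) //= lerDl sumr_ge0 // => t _.
    by rewrite mulr_ge0 ?sqr_ge0 // ltW.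
  rewrite -[v s 0 ^+ 2](mulKf (lt0r_neq0 (u0 s))).
  have us := ltW (u0 s); apply: ler_pM => //; first by rewrite invr_ge0.
  by rewrite mulr_ge0 ?sqr_ge0.
have HB : Y 0 0 <= B * (K * Q).
  rewrite mxE !big_distrl /=; apply: ler_sum => t _.
  rewrite mxE !big_distrl /=; apply: ler_sum => s _.
  rewrite mxE (le_trans (ler_norm _)) // !normrM mulrAC mulrC.
  apply: ler_wpM2l => //.
  (* The bound is 2 |v_s| |v_t| <= v_s^2 + v_t^2 <= 2 K Q. *)
  have := vK s; have := vK t; rewrite -!(real_normK (num_real (v _ 0))).
  have := sqr_ge0 (`|v s 0| - `|v t 0|).
  by move: `|v s 0| `|v t 0| (K * Q) => x y z; nra.
rewrite subr_gt0 mulrC ltr_pdivrMr //.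
by apply: (le_lt_trans HB); rewrite mulrDr mulr1 [Q * _]mulrC -mulrA ltrDr.
Qed.

(** * The certificate for the ball constraint *)

(** Turns a weighted sum of squared monomials into a diagonal Gram matrix; weights of indices with
    the same image under [phi] add up. *)
Lemma quadform_diag_pushforward (R : realType) n (I : {set 'I_n}) k
    (N : nat) (phi : 'I_N -> 'X_{1..n}) (w : 'I_N -> R) :
  (forall a, exists s : 'I_(msz I k), mon s = phi a) ->
  quadform (diag_mx (\row_(s < msz I k) \sum_(a | phi a == mon s) w a))
  = \sum_a w a *: 'X_[(phi a + phi a)%MM].
Proof.
move=> phiI; rewrite quadform_diag.
under eq_bigr => s _ do rewrite mxE scaler_suml.
rewrite (exchange_big_dep xpredT) //=; apply: eq_bigr => a _.
have [s sa] := phiI a; rewrite (big_pred1 s) ?sa // => t /=.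
by rewrite -sa eq_sym (inj_eq (@mon_inj _ _ _)).
Qed.

Lemma msuppXsq (R : realType) n (v : 'I_n) :
  msupp ('X_v ^+ 2 : {mpoly R[n]}) = [:: (U_(v) *+ 2)%MM].
Proof. by rewrite mpolyXn msuppX. Qed.

Lemma mcoeff_ball (R : realType) n (I : {set 'I_n}) (r : R) (v : 'I_n) :
  v \in I ->
  (r%:MP - \sum_(v in I) 'X_v ^+ 2 : {mpoly R[n]})@_(U_(v) *+ 2) = -1.
Proof.
move=> vI; rewrite mcoeffB mcoeffC -mdeg_eq0 mdegMn mdeg1 mulr0 sub0r.
rewrite raddf_sum (bigD1 v) //= mpolyXn mcoeffX eqxx big1 ?addr0 // => u /andP[_ uv].
rewrite mpolyXn mcoeffX; case: eqP => // /mnmP/(_ u).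
by rewrite !mulmnE !mnm1E eqxx eq_sym (negPf uv).
Qed.

Lemma cdeg_ball (R : realType) n (I : {set 'I_n}) (r : R) (v : 'I_n) :
  v \in I -> cdeg (r%:MP - \sum_(v in I) 'X_v ^+ 2 : {mpoly R[n]}) = 1%N.
Proof.
move=> vI; set b := (_ - _).
have b3 : (2 < msize b)%N.
  have vb : (U_(v) *+ 2)%MM \in msupp b.
    by rewrite mcoeff_msupp mcoeff_ball // oppr_eq0 oner_eq0.
  by have := msize_mdeg_lt vb; rewrite mdegMn mdeg1.
have b4 : (msize b <= 3)%N.
  rewrite msizeE; apply/bigmax_leqP_seq => m mb _.
  have := msuppB_le mb; rewrite mem_cat => /orP[|/msupp_sum_le].
    by rewrite msuppC; case: ifP => // _; rewrite inE => /eqP->; rewrite mdeg0.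
  case/flattenP => s /mapP[u _ ->]; rewrite msuppXsq inE => /eqP ->.
  by rewrite mdegMn mdeg1.
by rewrite /cdeg; have -> : msize b = 3%N by apply/eqP; rewrite eqn_leq b3 b4.
Qed.

(** The weight [wt] is a function on all multi-indices, so that it can fill blocks whose size
    depends on the constraint index without any transport. *)
Lemma ball_certificate (R : realType) n (I : {set 'I_n}) k (r c : R)
    (b : {mpoly R[n]}) :
  0 < r -> 0 < c -> b = r%:MP - \sum_(v in I) 'X_v ^+ 2 -> (cdeg b <= k)%N ->
  exists (u : 'rV[R]_(msz I k)) (wt : 'X_{1..n} -> R),
    [/\ forall s, 0 < u 0 s, forall m, 0 < wt m &
     c%:MP = quadform (diag_mx u)
       + b * quadform (diag_mx (\row_(s < msz I (k - cdeg b)) wt (mon s)))].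
Proof.
move=> r0 c0 bE bk; set D := (k - cdeg b)%N.
(* For nonempty [I] the ball has half-degree 1, so multiplying by a variable stays within degree k.
   For empty [I] it is a constant and no such shift occurs. *)
have DI v : v \in I -> D.+1 = k.
  by move=> vI; move: bk; rewrite /D bE (cdeg_ball _ vI); lia.
have Dk : (D <= k)%N by exact: leq_subr.
pose wt (m : 'X_{1..n}) : R := c / (2 * r) ^+ (mdeg m).+1.
have r2 : 0 < 2 * r by rewrite mulr_gt0.
have wt0 m : 0 < wt m by rewrite divr_gt0 // exprn_gt0.
have wtS m v : wt m = 2 * r * wt (m + U_(v))%MM.
  rewrite /wt mdegD mdeg1 addn1 [in RHS]exprS invfM.
  by rewrite mulrCA [2 * r * _]mulrA mulfV ?mul1r // gt_eqF.
pose push N (phi : 'I_N -> 'X_{1..n}) (w : 'I_N -> R) : 'rV[R]_(msz I k) :=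
  \row_s \sum_(a | phi a == mon s) w a.
pose w (a : 'I_(msz I D)) := wt (mon a).
(* The three terms are the coefficients of c, of -r w_a x^(2a), and of w_a x^(2(a + e_v)) for [v] in
   [I]. *)
pose u := push 1 (fun=> 0%MM) (fun=> c) - r *: push _ (@mon n I D) w
  + \sum_(v in I) push _ (fun a : 'I_(msz I D) => (mon a + U_(v))%MM) w.
exists u, wt; split=> // [s|].
  (* As [mon] is injective, the sum has at most one term. *)
  have pushw m : 0 <= \sum_(a < msz I D | mon a == m) w a <= wt m.
    have [/existsP[a /eqP am]|] := boolP [exists a, @mon n I D a == m].
      rewrite (big_pred1 a) => [|t /=]; first by rewrite /w am lexx andbT ltW.
      by rewrite -am (inj_eq (@mon_inj _ _ _)).
    rewrite negb_exists => /forallP h; rewrite big1 ?lexx ?ltW // => a.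
      by rewrite (negPf (h a)).
  have pushv : 0 <= \sum_(v in I) \sum_(a < msz I D | (mon a + U_(v))%MM == mon s) w a.
    by apply: sumr_ge0 => v _; apply: sumr_ge0 => a _; exact: ltW (wt0 _).
  rewrite !mxE summxE; under [X in _ + X]eq_bigr => v _ do rewrite mxE.
  (* At the constant monomial at most r w_0 = c / 2 is subtracted from c. *)
  have [s0|] := eqVneq (mon s) 0%MM.
    rewrite s0 in pushv *; rewrite ltr_wpDr // subr_gt0.
    rewrite [ltRHS]big_mkcond big_ord1.
    have /andP[_] := pushw 0%MM; rewrite -(ler_pM2l r0) => /le_lt_trans -> //.
    have -> : r * wt 0%MM = c / 2 by rewrite /wt mdeg0 expr1; field; rewrite gt_eqF.
    by lra.
  (* At any other monomial, lowering a variable [v] that occurs gives an index [a] whose shifted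
     term contributes w_a = 2 r w_(a + e_v), more than the r w_(a + e_v) that is subtracted at
     most. *)
  move=> sn0; have [v vs] : exists v, mon s v != 0%N.
    apply/existsP; apply: contraNT sn0; rewrite negb_exists => /forallP h.
    by apply/eqP/mnmP => i; rewrite mnm0E; apply/eqP; rewrite -[_ == _]negbK.
  have vI : v \in I by apply: contraNT vs => /mon_notin ->.
  have vle : (U_(v) <= mon s)%MM.
    by apply/mnm_lepP => i; rewrite mnm1E; case: eqP => // <-; rewrite lt0n.
  have [a aE] : exists a : 'I_(msz I D), mon a = (mon s - U_(v))%MM.
    apply: mon_surj => [|i iI]; last by rewrite mnmBE mon_notin.
    have := mdeg_mon s; rewrite -[X in (mdeg X <= _)%N](submK vle).
    by move: (DI v vI); rewrite mdegD mdeg1; lia.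
  have {aE} aE : (mon a + U_(v))%MM = mon s by rewrite aE submK.
  rewrite [X in X - _ + _]big_pred0 // sub0r addrC subr_gt0.
  have /andP[_] := pushw (mon s); rewrite -(ler_pM2l r0) => /le_lt_trans; apply.
  rewrite (bigD1 v) //= ltr_wpDr //.
    by apply: sumr_ge0 => ? _; apply: sumr_ge0 => ? _; exact: ltW (wt0 _).
  rewrite (bigD1 a) ?aE //= ltr_wpDr //.
    by apply: sumr_ge0 => ? _; exact: ltW (wt0 _).
  by rewrite /w (wtS (mon a) v) aE -mulrA mulr_natl mulr2n ltrDl mulr_gt0.
rewrite [X in b * X]quadform_diag; under [X in b * X]eq_bigr => s _ do rewrite mxE.
rewrite /u linearD linearB linearZ linear_sum /= linearD linearB linearZ linear_sum /=.
rewrite !quadform_diag_pushforward; last 2 first.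
- move=> a; apply: mon_surj => [|i /mon_notin ->//].
  exact: leq_trans (mdeg_mon _) Dk.
- by move=> _; apply: mon_surj => [|i _]; rewrite ?mdeg0 ?mnm0E.
rewrite big_ord1 addm0 mpolyX0 -mul_mpolyC mulr1.
rewrite -/w bE mulrBl mul_mpolyC mulr_suml -addrA.
rewrite [X in _ + (X + _)](_ : _ = \sum_(v in I) 'X_v ^+ 2 *
    \sum_a w a *: 'X_[(mon a + mon a)%MM]).
  by rewrite [X in _ + X]addrC subrK subrK.
apply: eq_bigr => v vI; rewrite quadform_diag_pushforward => [|a].
  rewrite mulr_sumr; apply: eq_bigr => a _.
  rewrite -scalerAr mpolyXn -mpolyXD; congr (_ *: 'X_[_]).
  by apply/mnmP => i; rewrite !mnmDE; lia.
apply: mon_surj => [|i iI].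
  by rewrite mdegD mdeg1 addn1 -(DI v vI) ltnS mdeg_mon.
by rewrite mnmDE mnm1E mon_notin // (negPf (memPn iI v vI)).
Qed.

(** * Positive constants in the quadratic module of one clique *)

Lemma ball_support_sub (R : realType) n (I I' : {set 'I_n}) (r : R) :
  poly_in I' (r%:MP - \sum_(v in I) 'X_v ^+ 2 : {mpoly R[n]}) -> I \subset I'.
Proof.
move=> bI'; apply/subsetP => v vI; apply/negPn/negP => vI'.
have vb : (U_(v) *+ 2)%MM \in msupp (r%:MP - \sum_(v in I) 'X_v ^+ 2 : {mpoly R[n]}).
  by rewrite mcoeff_msupp mcoeff_ball // oppr_eq0 oner_eq0.
by have := bI' _ vb _ vI'; rewrite mulmnE mnm1E eqxx.
Qed.

Lemma Qcirc_ball (R : realType) (n m p k : nat) (Ij : {set 'I_n})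
    (g : 'I_m -> {mpoly R[n]}) (J : 'I_m -> 'I_p) (i0 : 'I_m) (r c : R) :
  (forall i, J i = J i0 -> poly_in Ij (g i)) -> (forall i, cdeg (g i) <= k)%N ->
  0 < r -> g i0 = r%:MP - \sum_(v in Ij) 'X_v ^+ 2 -> 0 < c ->
  Qcirc k Ij g J (J i0) c%:MP.
Proof.
move=> gI gk r0 gi0 c0.
have [u [wt [u0 wt0 cE]]] := ball_certificate r0 c0 gi0 (gk i0).
pose rest := \sum_(i < m | (J i == J i0) && (i != i0))
  g i * quadform (1%:M : 'M[R]_(msz Ij (k - cdeg (g i)))).
have [H symH restE] : sym_gram Ij k rest.
  by apply: sym_gram_sum => i /andP[/eqP iJ _]; apply: sym_gram_mul => //; exact: gI.
have [e e0 G0pos] := posdef_diag_perturb u0 symH.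
exists (diag_mx u - e *: H); split=> //.
(* The ball keeps its certificate weights; every other constraint gets [e] times the identity,
   compensated by - e H in the first block. *)
exists (fun i => diag_mx (\row_s if i == i0 then wt (mon s) else e)); split=> [i _|].
  by apply: posdef_diag => s; rewrite mxE; case: ifP.
rewrite (bigD1 i0) //= eqxx cE linearB linearZ /= -restE.
rewrite (eq_bigr (fun i => e *: (g i * quadform
    (1%:M : 'M[R]_(msz Ij (k - cdeg (g i))))))) => [|i /andP[_ /negPf ->]].
  by rewrite -scaler_sumr -/rest [X in _ = _ + X]addrC addrA subrK.
rewrite scalerAr -linearZ /= scalemx1 -diag_const_mx; congr (_ * quadform (diag_mx _)).
by apply/rowP => s; rewrite !mxE.
Qed.

(** * The Riesz functional and the constant trace property *)

(** Monomials of degree above 2k are sent to 0, in agreement with the default value of [ymom]. *)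
Definition riesz (R : realType) n k (y : {ffun 'X_{1..n < (2 * k).+1} -> R})
    (q : {mpoly R[n]}) : R :=
  \sum_(b : 'X_{1..n < (2 * k).+1}) q@_b * y b.

Lemma riesz_is_linear (R : realType) n k
    (y : {ffun 'X_{1..n < (2 * k).+1} -> R}) : scalar (riesz y).
Proof.
move=> a q1 q2; rewrite /riesz mulr_sumr -big_split; apply: eq_bigr => b _ /=.
by rewrite mcoeffD mcoeffZ mulrDl mulrA.
Qed.
HB.instance Definition _ (R : realType) n k
    (y : {ffun 'X_{1..n < (2 * k).+1} -> R}) :=
  GRing.isLinear.Build R {mpoly R[n]} R _ (riesz y) (riesz_is_linear y).

Lemma rieszX (R : realType) n k (y : {ffun 'X_{1..n < (2 * k).+1} -> R}) a :
  riesz y 'X_[a] = ymom y a.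
Proof.
rewrite /riesz /ymom; case: insubP => [b _ ba|an].
  rewrite (bigD1 b) //= mcoeffX ba eqxx mul1r big1 ?addr0 // => b' b'b.
  by rewrite mcoeffX -ba eq_sym [_ == _](negPf b'b) mul0r.
rewrite big1 // => b _; rewrite mcoeffX; case: eqP => [ab|]; last by rewrite mul0r.
by rewrite ab bmdeg in an.
Qed.

Lemma riesz_mul_quadform (R : realType) n k
    (y : {ffun 'X_{1..n < (2 * k).+1} -> R}) (q : {mpoly R[n]})
    (I : {set 'I_n}) d (G : 'M[R]_(msz I d)) :
  riesz y (q * quadform G) = \tr (G *m locmat y q I d).
Proof.
rewrite /mxtrace /quadform mulr_sumr linear_sum; apply: eq_bigr => s _ /=.
rewrite mulr_sumr linear_sum mxE; apply: eq_bigr => t _ /=.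
rewrite -scalerAr linearZ /= mxE; congr (_ * _).
rewrite {1}[q]mpolyE mulr_suml linear_sum; apply: eq_bigr => c _ /=.
by rewrite -scalerAl linearZ /= -mpolyXD rieszX addmC [(mon t + _)%MM]addmC.
Qed.

Lemma riesz_quadform (R : realType) n k
    (y : {ffun 'X_{1..n < (2 * k).+1} -> R})
    (I : {set 'I_n}) d (G : 'M[R]_(msz I d)) :
  riesz y (quadform G) = \tr (G *m momat y I d).
Proof.
(* The moment matrix is the localizing matrix of the constant 1. *)
rewrite -[quadform G]mul1r riesz_mul_quadform; congr (\tr (_ *m _)).
by apply/matrixP => s t; rewrite !mxE msupp1 big_seq1 mcoeff1 eqxx mul1r addm0.
Qed.

Lemma mxtrace_sandwich (R : comNzRingType) N (P M : 'M[R]_N) :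
  \tr (P *m M *m P) = \tr ((P *m P) *m M).
Proof. by rewrite mxtrace_mulC mulmxA. Qed.

Lemma CTP_cs_of_Qcirc (R : realType) (n m l p : nat) (f : {mpoly R[n]})
    (g : 'I_m -> {mpoly R[n]}) (h : 'I_l -> {mpoly R[n]})
    (I : 'I_p -> {set 'I_n}) (J : 'I_m -> 'I_p) (W : 'I_l -> 'I_p) :
  (forall k, (kmin f g h <= k)%N -> forall j, Qcirc k (I j) g J j 1%:MP) ->
  CTP_cs f g h I J W.
Proof.
move=> Q1 k kk j; have [G0 [G0pos [G [Gpos E]]]] := Q1 k kk j.
have [P0 [P0pos P0E]] := posdef_sqrt G0pos.
have /fin_all_exists[P PE] : forall i, exists Pi,
    J i = j -> posdef Pi /\ Pi *m Pi = G i.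
  move=> i; have [ij|ij] := eqVneq (J i) j; last first.
    by exists 0 => /eqP; rewrite (negPf ij).
  by have [Pi hPi] := posdef_sqrt (Gpos i ij); exists Pi.
(* The constant trace is the Riesz functional at 1, that is y_0 = 1. *)
exists 1; split=> //; exists P0; split=> //; exists P; split=> [i ij|y _ y0].
  by have [] := PE i ij.
rewrite mxtrace_sandwich P0E -riesz_quadform.
rewrite (eq_bigr (fun i => riesz y (g i * quadform (G i)))) => [|i /eqP ij].
  by rewrite -linear_sum -linearD /= -E mpolyC1 -mpolyX0 rieszX.
by have [_ PG] := PE i ij; rewrite mxtrace_sandwich PG riesz_mul_quadform.
Qed.

Theorem theorem3 (R : realType) (n m l p : nat)
  (f : {mpoly R[n]}) (g : 'I_m -> {mpoly R[n]}) (h : 'I_l -> {mpoly R[n]})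
  (I : 'I_p -> {set 'I_n}) (J : 'I_m -> 'I_p) (W : 'I_l -> 'I_p)
  (HI : forall j j' : 'I_p, I j \subset I j' -> j = j')
  (HJ : forall i : 'I_m, poly_in (I (J i)) (g i))
  (HW : forall i : 'I_l, poly_in (I (W i)) (h i))
  (Hball : forall j : 'I_p, exists Rj : R, 0 < Rj /\
     exists i : 'I_m, g i = Rj%:MP - \sum_(v in I j) 'X_v ^+ 2) :
  (forall k : nat, (kmin f g h <= k)%N -> forall j : 'I_p,
     forall c : R, 0 < c -> Qcirc k (I j) g J j c%:MP)
  /\ CTP_cs f g h I J W.
Proof.
have main k : (kmin f g h <= k)%N -> forall j (c : R), 0 < c ->
    Qcirc k (I j) g J j c%:MP.
  move=> kk j c c0; have [r [r0 [i0 gi0]]] := Hball j.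
  (* The ball polynomial of clique [j] lies among all the constraints, but its block [J i0] is not
     given. It involves every variable of [I j], so [I j] is contained in [I (J i0)], and distinct
     cliques are not nested. *)
  have jE : j = J i0.
    by apply/HI/(ball_support_sub (r := r)); rewrite -gi0.
  rewrite {2}jE; apply: (Qcirc_ball (r := r)) => // i.
    by move=> iJ; rewrite jE -iJ.
  move: kk; rewrite /kmin !geq_max => /and3P[_ gk _].
  exact: leq_trans (leq_bigmax _) gk.
split=> //; apply: CTP_cs_of_Qcirc => k kk j; exact: main.
Qed.
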